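(* Consider the FDTD (Yee-grid) model, described in the context, of a plane harmonic wave normally incident on a planar interface between two magnetics with relative permeabilities $\mu_1,\mu_2$ and common relative permittivity $\varepsilon$. The FDTD analogs $\widetilde t,\widetilde r$ of the Fresnel transmission and reflection coefficients for this interface, i.e. the coefficients determined by the interface conditions (a) and (b) of the context with numerical wavenumbers $\widetilde k_1,\widetilde k_2$ given by the Yee dispersion relation, are $$ \widetilde{t}=\frac{2\eta_2\cos\left(\frac{\widetilde{k}_1\Delta_x}{2}\right)}{\eta_2\cos\left(\frac{\widetilde{k}_1\Delta_x}{2}\right)+\eta_1\cos\left(\frac{\widetilde{k}_2\Delta_x}{2}\right)},\qquad \widetilde{r}=\frac{\eta_2\cos\left(\frac{\widetilde{k}_1\Delta_x}{2}\right)-\eta_1\cos\left(\frac{\widetilde{k}_2\Delta_x}{2}\right)}{\eta_2\cos\left(\frac{\widetilde{k}_1\Delta_x}{2}\right)+\eta_1\cos\left(\frac{\widetilde{k}_2\Delta_x}{2}\right)}. $$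
   Context: Media: both media are lossless, linear, homogeneous, isotropic and stationary, with real positive constants $\varepsilon,\mu_1,\mu_2$; there are no external currents or free charges, including on the interface. $\varepsilon_0,\mu_0$ are the vacuum permittivity and permeability, $c=1/\sqrt{\varepsilon_0\mu_0}$. The grid has time step $\Delta_t$ and space step $\Delta_x$; the Courant number is $S_{\mathrm c}=c\Delta_t/\Delta_x$. For $j=1,2$, medium $j$ has refractive index $n_{j}=\sqrt{\varepsilon\mu_j}$ and impedance $\eta_j=\sqrt{\mu_0/\varepsilon_0}\,\sqrt{\mu_j/\varepsilon}$. The wave has angular frequency $\omega$, and the numerical wavenumber $\widetilde k_j$ in medium $j$ is determined by the Yee dispersion relation $\sin(\widetilde k_j\Delta_x/2)=\frac{n_j}{S_{\mathrm c}}\sin(\omega\Delta_t/2)$. Let $\xi\in\frac12\mathbb{Z}$ denote position in units of $\Delta_x$ relative to the interface ($\xi=0$; medium 1 is $\xi<0$, medium 2 is $\xi>0$) and $q\in\frac12\mathbb{Z}$ time in units of $\Delta_t$. The discrete fields, with $E_0$ the amplitude of the incident wave, are incident: $E^{(i)\,q}[\xi]=E_0e^{i(\omega q\Delta_t-\widetilde k_1\xi\Delta_x)}$, $H^{(i)\,q}[\xi]=-\frac{E_0}{\eta_1}e^{i(\omega q\Delta_t-\widetilde k_1\xi\Delta_x)}$; reflected: $E^{(r)\,q}[\xi]=\widetilde rE_0e^{i(\omega q\Delta_t+\widetilde k_1\xi\Delta_x)}$, $H^{(r)\,q}[\xi]=\widetilde r\frac{E_0}{\eta_1}e^{i(\omega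 q\Delta_t+\widetilde k_1\xi\Delta_x)}$; transmitted: $E^{(t)\,q}[\xi]=\widetilde tE_0e^{i(\omega q\Delta_t-\widetilde k_2\xi\Delta_x)}$, $H^{(t)\,q}[\xi]=-\widetilde t\frac{E_0}{\eta_2}e^{i(\omega q\Delta_t-\widetilde k_2\xi\Delta_x)}$. Magnetic interface model: the interface $\xi=0$ is an electric-field node of the Yee grid; the nearest magnetic nodes $\xi=-\frac12$ and $\xi=+\frac12$ lie strictly in media 1 and 2. Write $H^q[-\tfrac12]=H^{(i)\,q}[-\tfrac12]+H^{(r)\,q}[-\tfrac12]$ and $H^q[\tfrac12]=H^{(t)\,q}[\tfrac12]$. The interface conditions are: (a) (continuity of the tangential electric field) $E^{(i)\,q}[0]+E^{(r)\,q}[0]=E^{(t)\,q}[0]$, with $E^q[0]$ denoting this common value; after cancelling $E_0e^{i\omega q\Delta_t}$ this reads $1+\widetilde r=\widetilde t$; (b) (discrete Ampère law at the interface node) $\varepsilon_0\varepsilon\,\dfrac{E^{q+1/2}[0]-E^{q-1/2}[0]}{\Delta_t}=\dfrac{H^q[\frac12]-H^q[-\frac12]}{\Delta_x}$; after cancelling $E_0e^{i\omega q\Delta_t}$ and multiplying by $\eta_1\Delta_x$ this reads $e^{i\widetilde k_1\Delta_x/2}-\widetilde r\,e^{-i\widetilde k_1\Delta_x/2}=\eta_1\left(\frac{e^{-i\widetilde k_2\Delta_x/2}}{\eta_2}+i\Omega\varepsilon_0\varepsilon\Delta_x\right)\widetilde t$, where $\Omega=\frac{2}{\Delta_t}\sin\left(\frac{\omega\Delta_t}{2}\right)$.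 *)

(* Defs.v *)
From Stdlib Require Import Reals ZArith.
From Coquelicot Require Import Coquelicot.
Open Scope R_scope.

(** * Complex exponential and trigonometric functions *)

Definition Cexp (z : C) : C := (RtoC (exp (Re z)) * (cos (Im z), sin (Im z)))%C.

Definition Ccos (z : C) : C :=
  ((Cexp (Ci * z) + Cexp (- (Ci * z))) / RtoC 2)%C.

Definition Csin (z : C) : C :=
  ((Cexp (Ci * z) - Cexp (- (Ci * z))) / (RtoC 2 * Ci))%C.

(** * Media, grid and wave *)

(** Medium 1 fills [xi < 0] and medium 2 fills [xi > 0]. *)
Record magnetic_setup : Type := MagneticSetup {
  eps0 : R;   (* vacuum permittivity *)
  mu0 : R;    (* vacuum permeability *)
  eps : R;    (* common relative permittivity *)
  mu1 : R;    (* relative permeability of medium 1 *)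
  mu2 : R;    (* relative permeability of medium 2 *)
  dt : R;     (* time step *)
  dx : R;     (* space step *)
  omega : R;  (* angular frequency *)
  eps0_pos : 0 < eps0;
  mu0_pos : 0 < mu0;
  eps_pos : 0 < eps;
  mu1_pos : 0 < mu1;
  mu2_pos : 0 < mu2;
  dt_pos : 0 < dt;
  dx_pos : 0 < dx
}.

Definition light_speed (s : magnetic_setup) : R := 1 / sqrt (eps0 s * mu0 s).

Definition courant (s : magnetic_setup) : R := light_speed s * dt s / dx s.

(** [mu] stands for either of [mu1 s], [mu2 s]. *)
Definition refractive_index (s : magnetic_setup) (mu : R) : R := sqrt (eps s * mu).

Definition impedance (s : magnetic_setup) (mu : R) : R :=
  sqrt (mu0 s / eps0 s) * sqrt (mu / eps s).

(** Wavenumbers are complex: when the right-hand side exceeds 1 in absolute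
    value the relation has only non-real solutions.  The relation fixes [k] only
    up to the choice of a branch of the arcsine, and none is imposed here. *)
Definition yee_dispersion (s : magnetic_setup) (mu : R) (k : C) : Prop :=
  Csin (k * RtoC (dx s) / RtoC 2) =
  RtoC (refractive_index s mu / courant s * sin (omega s * dt s / 2)).

(** * Discrete fields

    The time [q] and the position [xi] are in units of [dt s] and [dx s]. *)

Definition half_integer (q : R) : Prop := exists m : Z, q = IZR m / 2.

Definition E_inc (s : magnetic_setup) (E0 k1 : C) (q xi : R) : C :=
  (E0 * Cexp (Ci * (RtoC (omega s * q * dt s) - k1 * RtoC (xi * dx s))))%C.

Definition H_inc (s : magnetic_setup) (E0 k1 : C) (q xi : R) : C :=
  (- (E0 / RtoC (impedance s (mu1 s)))
   * Cexp (Ci * (RtoC (omega s * q * dt s) - k1 * RtoC (xi * dx s))))%C.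

Definition E_ref (s : magnetic_setup) (E0 k1 r : C) (q xi : R) : C :=
  (r * E0 * Cexp (Ci * (RtoC (omega s * q * dt s) + k1 * RtoC (xi * dx s))))%C.

Definition H_ref (s : magnetic_setup) (E0 k1 r : C) (q xi : R) : C :=
  (r * (E0 / RtoC (impedance s (mu1 s)))
   * Cexp (Ci * (RtoC (omega s * q * dt s) + k1 * RtoC (xi * dx s))))%C.

Definition E_tr (s : magnetic_setup) (E0 k2 t : C) (q xi : R) : C :=
  (t * E0 * Cexp (Ci * (RtoC (omega s * q * dt s) - k2 * RtoC (xi * dx s))))%C.

Definition H_tr (s : magnetic_setup) (E0 k2 t : C) (q xi : R) : C :=
  (- (t * (E0 / RtoC (impedance s (mu2 s))))
   * Cexp (Ci * (RtoC (omega s * q * dt s) - k2 * RtoC (xi * dx s))))%C.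

(** * Interface conditions

    The interface [xi = 0] is an electric node. *)

Definition E_continuity (s : magnetic_setup) (E0 k1 k2 r t : C) : Prop :=
  forall q : R, half_integer q ->
    (E_inc s E0 k1 q 0 + E_ref s E0 k1 r q 0)%C = E_tr s E0 k2 t q 0.

(** The electric field at the node is written as its value from medium 1; by
    [E_continuity] this is also its value from medium 2. *)
Definition E_node (s : magnetic_setup) (E0 k1 r : C) (q : R) : C :=
  (E_inc s E0 k1 q 0 + E_ref s E0 k1 r q 0)%C.

Definition discrete_ampere (s : magnetic_setup) (E0 k1 k2 r t : C) : Prop :=
  forall q : R, half_integer q ->
    (RtoC (eps0 s * eps s)
     * ((E_node s E0 k1 r (q + 1/2) - E_node s E0 k1 r (q - 1/2)) / RtoC (dt s)))%C
    = ((H_tr s E0 k2 t q (1/2)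
        - (H_inc s E0 k1 q (-1/2) + H_ref s E0 k1 r q (-1/2))) / RtoC (dx s))%C.

Definition interface_conditions (s : magnetic_setup) (E0 k1 k2 r t : C) : Prop :=
  E_continuity s E0 k1 k2 r t /\ discrete_ampere s E0 k1 k2 r t.

(** [r] and [t] are the reflection and transmission coefficients determined by
    the interface conditions, i.e. the only solution of these conditions. *)
Definition fdtd_fresnel (s : magnetic_setup) (E0 k1 k2 r t : C) : Prop :=
  interface_conditions s E0 k1 k2 r t /\
  forall r' t' : C, interface_conditions s E0 k1 k2 r' t' -> r' = r /\ t' = t.

(* Main.v *)
Require Import Defs.
From Stdlib Require Import Reals ZArith Lra.
From Coquelicot Require Import Coquelicot.
Open Scope R_scope.

(** The Yee dispersion relation says [sin (k_j dx / 2) = eta_j P] with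
    [P = eps0 eps (dx / dt) sin (omega dt / 2)] the same in both media.  Expanding
    the half-cell phases in Ampere's law by Euler's formula, each side of the
    interface therefore contributes [i P t], which together cancel the
    displacement current [2 i P t].  What is left is
    [eta2 cos1 (1 - r) = eta1 cos2 t], to be solved with [1 + r = t]. *)

(** * Complex exponential and Euler's formulas *)

Lemma Cexp_plus (a b : C) : Cexp (a + b) = (Cexp a * Cexp b)%C.
Proof.
unfold Cexp; destruct a as [a1 a2], b as [b1 b2]; simpl.
rewrite exp_plus, cos_plus, sin_plus.
apply injective_projections; simpl; ring.
Qed.

Lemma Cexp_0 : Cexp 0 = 1%C.
Proof.
unfold Cexp; simpl; rewrite exp_0, cos_0, sin_0.
apply injective_projections; simpl; ring.
Qed.

Lemma Cexp_neq_0 (z : C) : Cexp z <> 0.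
Proof.
intros H; apply C1_nz.
replace (RtoC 1) with (Cexp (z + - z)).
- now rewrite Cexp_plus, H, Cmult_0_l.
- now rewrite Cplus_opp_r, Cexp_0.
Qed.

Lemma C2_nz : RtoC 2 <> 0.
Proof. intros H; apply RtoC_inj in H; lra. Qed.

Lemma Cexp_Euler (z : C) : Cexp (Ci * z) = (Ccos z + Ci * Csin z)%C.
Proof. unfold Ccos, Csin; field; exact Ci_nz. Qed.

Lemma Cexp_Euler_opp (z : C) : Cexp (- (Ci * z)) = (Ccos z - Ci * Csin z)%C.
Proof. unfold Ccos, Csin; field; exact Ci_nz. Qed.

Lemma Cexp_Ci_RtoC (x : R) : Cexp (Ci * RtoC x) = (RtoC (cos x) + Ci * RtoC (sin x))%C.
Proof.
unfold Cexp; simpl.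
replace (0 * x - 1 * 0) with 0 by ring.
replace (0 * 0 + 1 * x) with x by ring.
rewrite exp_0; apply injective_projections; simpl; ring.
Qed.

Lemma Cexp_opp_Ci_RtoC (x : R) :
  Cexp (- (Ci * RtoC x)) = (RtoC (cos x) - Ci * RtoC (sin x))%C.
Proof.
replace (- (Ci * RtoC x))%C with (Ci * RtoC (- x))%C.
- rewrite Cexp_Ci_RtoC, cos_neg, sin_neg, RtoC_opp; ring.
- rewrite RtoC_opp; ring.
Qed.

Lemma Ccos_RtoC (x : R) : Ccos (RtoC x) = RtoC (cos x).
Proof.
unfold Ccos; rewrite Cexp_Ci_RtoC, Cexp_opp_Ci_RtoC.
field.
Qed.

(** * Impedances and the Yee dispersion relation *)

Lemma impedance_pos (s : magnetic_setup) (mu : R) : 0 < mu -> 0 < impedance s mu.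
Proof.
intros Hmu; unfold impedance.
apply Rmult_lt_0_compat; apply sqrt_lt_R0, Rdiv_lt_0_compat; auto.
- apply mu0_pos.
- apply eps0_pos.
- apply eps_pos.
Qed.

Lemma refractive_index_impedance (s : magnetic_setup) (mu : R) : 0 < mu ->
  refractive_index s mu / light_speed s = impedance s mu * (eps0 s * eps s).
Proof.
intros Hmu; unfold refractive_index, light_speed, impedance.
pose proof (eps0_pos s) as He0; pose proof (mu0_pos s) as Hm0.
pose proof (eps_pos s) as He.
assert (Hs : 0 < sqrt (eps0 s * mu0 s)) by (apply sqrt_lt_R0; nra).
transitivity (sqrt (eps s * mu) * sqrt (eps0 s * mu0 s)); [field; lra |].
(* Each product becomes a quotient times a square, so that its root splits off one factor of
   [impedance]. *)
replace (eps s * mu) with (mu / eps s * (eps s * eps s)) by (field; lra).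
replace (eps0 s * mu0 s) with (mu0 s / eps0 s * (eps0 s * eps0 s)) by (field; lra).
rewrite (sqrt_mult_alt (mu / eps s)) by (apply Rlt_le, Rdiv_lt_0_compat; lra).
rewrite (sqrt_mult_alt (mu0 s / eps0 s)) by (apply Rlt_le, Rdiv_lt_0_compat; lra).
rewrite !sqrt_square by lra; ring.
Qed.

(** The constant [P]: half of the coefficient [Omega eps0 eps dx] of the displacement current. It
    involves no permeability. *)
Definition displacement (s : magnetic_setup) : R :=
  eps0 s * eps s * (dx s / dt s) * sin (omega s * dt s / 2).

(** In this form the whole dependence on [mu] sits in the impedance, which cancels against the
    [1 / eta_j] in the magnetic amplitudes. *)
Lemma yee_dispersion_impedance (s : magnetic_setup) (mu : R) (k : C) : 0 < mu ->
  yee_dispersion s mu k ->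
  Csin (k * RtoC (dx s) / RtoC 2) = (RtoC (impedance s mu) * RtoC (displacement s))%C.
Proof.
intros Hmu ->; rewrite <- RtoC_mult; f_equal.
pose proof (dt_pos s); pose proof (dx_pos s).
assert (Hc : light_speed s <> 0).
{ apply Rgt_not_eq, Rdiv_lt_0_compat; [lra | apply sqrt_lt_R0].
  apply Rmult_lt_0_compat; [apply eps0_pos | apply mu0_pos]. }
unfold displacement, courant.
transitivity (refractive_index s mu / light_speed s * (dx s / dt s)
              * sin (omega s * dt s / 2)).
- field; lra.
- rewrite refractive_index_impedance by assumption; ring.
Qed.

(** * Phases of the waves at the nodes next to the interface *)

(** The factor shared by all fields at time [q], to be cancelled from both interface conditions. *)
Definition time_phase (s : magnetic_setup) (q : R) : C :=
  Cexp (Ci * RtoC (omega s * q * dt s)).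

Lemma time_phase_plus (s : magnetic_setup) (q : R) :
  time_phase s (q + 1 / 2)
  = (time_phase s q * Cexp (Ci * RtoC (omega s * dt s / 2)))%C.
Proof.
unfold time_phase; rewrite <- Cexp_plus; f_equal.
replace (omega s * (q + 1 / 2) * dt s)
  with (omega s * q * dt s + omega s * dt s / 2) by field.
rewrite RtoC_plus; ring.
Qed.

Lemma time_phase_minus (s : magnetic_setup) (q : R) :
  time_phase s (q - 1 / 2)
  = (time_phase s q * Cexp (- (Ci * RtoC (omega s * dt s / 2))))%C.
Proof.
unfold time_phase; rewrite <- Cexp_plus; f_equal.
replace (omega s * (q - 1 / 2) * dt s)
  with (omega s * q * dt s - omega s * dt s / 2) by field.
rewrite RtoC_minus; ring.
Qed.

Lemma Cexp_wave_0 (s : magnetic_setup) (k : C) (q : R) :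
  Cexp (Ci * (RtoC (omega s * q * dt s) - k * RtoC (0 * dx s))) = time_phase s q
  /\ Cexp (Ci * (RtoC (omega s * q * dt s) + k * RtoC (0 * dx s))) = time_phase s q.
Proof.
unfold time_phase; rewrite Rmult_0_l; split; f_equal; ring.
Qed.

Lemma RtoC_half (x : R) : RtoC (1 / 2 * x) = (RtoC x / RtoC 2)%C.
Proof. rewrite <- RtoC_div by lra; f_equal; field. Qed.

Lemma RtoC_opp_half (x : R) : RtoC (-1 / 2 * x) = (- (RtoC x / RtoC 2))%C.
Proof. rewrite <- RtoC_div, <- RtoC_opp by lra; f_equal; field. Qed.

Lemma Cexp_wave_right (s : magnetic_setup) (k : C) (q : R) :
  Cexp (Ci * (RtoC (omega s * q * dt s) - k * RtoC (1 / 2 * dx s)))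
  = (time_phase s q * Cexp (- (Ci * (k * RtoC (dx s) / RtoC 2))))%C.
Proof.
unfold time_phase; rewrite <- Cexp_plus, RtoC_half; f_equal.
field.
Qed.

Lemma Cexp_wave_left_inc (s : magnetic_setup) (k : C) (q : R) :
  Cexp (Ci * (RtoC (omega s * q * dt s) - k * RtoC (-1 / 2 * dx s)))
  = (time_phase s q * Cexp (Ci * (k * RtoC (dx s) / RtoC 2)))%C.
Proof.
unfold time_phase; rewrite <- Cexp_plus, RtoC_opp_half; f_equal.
field.
Qed.

Lemma Cexp_wave_left_ref (s : magnetic_setup) (k : C) (q : R) :
  Cexp (Ci * (RtoC (omega s * q * dt s) + k * RtoC (-1 / 2 * dx s)))
  = (time_phase s q * Cexp (- (Ci * (k * RtoC (dx s) / RtoC 2))))%C.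
Proof.
unfold time_phase; rewrite <- Cexp_plus, RtoC_opp_half; f_equal.
field.
Qed.

(** * Equations up to nonzero factors, and over all times *)

Lemma Copp_neq_0 (z : C) : z <> 0 -> (- z)%C <> 0.
Proof.
intros Hz H; apply Hz; replace z with (- - z)%C by ring; rewrite H; ring.
Qed.

Lemma Cinv_neq_0 (z : C) : z <> 0 -> (/ z)%C <> 0.
Proof.
intros Hz H; apply C1_nz; rewrite <- (Cinv_r z Hz), H; ring.
Qed.

Lemma Cmult_eq_0_iff (a z : C) : a <> 0 -> (a * z)%C = 0 <-> z = 0.
Proof.
intros Ha; split; intros H.
- destruct (Ceq_dec z 0) as [Hz | Hz]; [exact Hz |].
  now destruct (Cmult_neq_0 a z Ha Hz).
- rewrite H; ring.
Qed.

Lemma Cminus_eq_0_iff (a b : C) : a = b <-> (a - b)%C = 0.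
Proof.
split; intros H.
- rewrite H; ring.
- replace a with (a - b + b)%C by ring; rewrite H; ring.
Qed.

(** Reduces the cancellation of a common factor [u] to one algebraic identity, which [ring] or
    [field] can check. *)
Lemma Ceq_scaled_iff (u a b c d : C) : u <> 0 ->
  (a - b)%C = (u * (c - d))%C -> a = b <-> c = d.
Proof.
intros Hu H.
now rewrite (Cminus_eq_0_iff a), (Cminus_eq_0_iff c), H, Cmult_eq_0_iff.
Qed.

(** Once the time phase cancels, the condition no longer depends on [q], so the instance [q = 0]
    already yields it. *)
Lemma forall_half_integer_iff (P : R -> Prop) (Q : Prop) :
  (forall q, P q <-> Q) -> (forall q, half_integer q -> P q) <-> Q.
Proof.
intros H; split.
- intros HP; apply (H 0), HP; exists 0%Z; simpl; field.
- intros HQ q _; now apply H.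
Qed.

(** * Interface conditions as a linear system in [r] and [t], and its solution *)

Lemma E_continuity_iff (s : magnetic_setup) (E0 k1 k2 r t : C) : E0 <> 0 ->
  E_continuity s E0 k1 k2 r t <-> t = (1 + r)%C.
Proof.
intros HE0; apply forall_half_integer_iff; intros q.
unfold E_inc, E_ref, E_tr.
rewrite !(proj1 (Cexp_wave_0 _ _ _)), !(proj2 (Cexp_wave_0 _ _ _)).
apply (Ceq_scaled_iff (- (E0 * time_phase s q))); [| ring].
now apply Copp_neq_0, Cmult_neq_0; [| apply Cexp_neq_0].
Qed.

Lemma discrete_ampere_iff (s : magnetic_setup) (E0 k1 k2 r t : C) : E0 <> 0 ->
  yee_dispersion s (mu1 s) k1 ->
  yee_dispersion s (mu2 s) k2 ->
  t = (1 + r)%C ->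
  discrete_ampere s E0 k1 k2 r t <->
  (RtoC (impedance s (mu2 s)) * Ccos (k1 * RtoC (dx s) / RtoC 2) * (1 - r))%C
  = (RtoC (impedance s (mu1 s)) * Ccos (k2 * RtoC (dx s) / RtoC 2) * t)%C.
Proof.
intros HE0 Hk1 Hk2 Ht; apply forall_half_integer_iff; intros q.
apply yee_dispersion_impedance in Hk1; [| apply mu1_pos].
apply yee_dispersion_impedance in Hk2; [| apply mu2_pos].
pose proof (dt_pos s) as Hdt; pose proof (dx_pos s) as Hdx.
pose proof (impedance_pos s (mu1 s) (mu1_pos s)) as He1.
pose proof (impedance_pos s (mu2 s) (mu2_pos s)) as He2.
assert (Hnz : forall x : R, 0 < x -> RtoC x <> 0).
{ intros x Hx H; apply RtoC_inj in H; lra. }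
unfold E_node, E_inc, E_ref, H_tr, H_inc, H_ref.
rewrite !(proj1 (Cexp_wave_0 _ _ _)), !(proj2 (Cexp_wave_0 _ _ _)).
rewrite Cexp_wave_right, Cexp_wave_left_inc, Cexp_wave_left_ref.
rewrite time_phase_plus, time_phase_minus, Cexp_Ci_RtoC, Cexp_opp_Ci_RtoC.
rewrite Cexp_Euler, !Cexp_Euler_opp, Hk1, Hk2.
unfold displacement; rewrite !RtoC_mult, RtoC_div by lra.
apply Hnz in Hdt, Hdx, He1, He2.
set (e1 := RtoC (impedance s (mu1 s))) in *.
set (e2 := RtoC (impedance s (mu2 s))) in *.
set (T := time_phase s q).
assert (HT : T <> 0) by apply Cexp_neq_0.
(* The denominator clears both impedances and the space step; the sign appears because the magnetic
   difference stands on the right of Ampère's law. *)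
apply (Ceq_scaled_iff (- (E0 * T / (e1 * e2 * RtoC (dx s))))).
- apply Copp_neq_0, Cmult_neq_0; [now apply Cmult_neq_0 |].
  now apply Cinv_neq_0; repeat apply Cmult_neq_0.
(* Continuity enters here: medium 1 contributes [i P (1 + r)], which must be identified with [i P t]
   for the displacement current to cancel. *)
- rewrite Ht; field; auto.
Qed.

Lemma interface_conditions_iff (s : magnetic_setup) (E0 k1 k2 r t : C) : E0 <> 0 ->
  yee_dispersion s (mu1 s) k1 ->
  yee_dispersion s (mu2 s) k2 ->
  interface_conditions s E0 k1 k2 r t <->
  t = (1 + r)%C /\
  (RtoC (impedance s (mu2 s)) * Ccos (k1 * RtoC (dx s) / RtoC 2) * (1 - r))%C
  = (RtoC (impedance s (mu1 s)) * Ccos (k2 * RtoC (dx s) / RtoC 2) * t)%C.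
Proof.
intros HE0 Hk1 Hk2; unfold interface_conditions.
rewrite E_continuity_iff by assumption.
split; intros [Ht H]; (split; [exact Ht |]);
  now apply (discrete_ampere_iff s E0 k1 k2 r t).
Qed.

(** If [x + y = 0], the system is either inconsistent or, when [x = y = 0],
    underdetermined. *)
Lemma unique_solution_iff (x y r t : C) :
  ((t = (1 + r)%C /\ (x * (1 - r))%C = (y * t)%C) /\
   forall r' t' : C,
     t' = (1 + r')%C /\ (x * (1 - r'))%C = (y * t')%C -> r' = r /\ t' = t)
  <-> (x + y)%C <> 0 /\ t = (2 * x / (x + y))%C /\ r = ((x - y) / (x + y))%C.
Proof.
assert (Hsol : forall r t : C, (x + y)%C <> 0 ->
  t = (1 + r)%C /\ (x * (1 - r))%C = (y * t)%C ->
  t = (2 * x / (x + y))%C /\ r = ((x - y) / (x + y))%C).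
{ intros r0 t0 HD [-> H].
  assert (Hr : r0 = ((x - y) / (x + y))%C).
  { replace r0 with ((x + y) * r0 / (x + y))%C by (field; exact HD).
    f_equal.
    (* Eliminating [t] gives [(x + y) r0 = x - y]; the two products inserted here cancel by [H]. *)
    replace ((x + y) * r0)%C with (x + y * (1 + r0) - x * (1 - r0) - y)%C by ring.
    rewrite H; ring. }
  split; [| exact Hr].
  rewrite Hr; apply Cminus_eq_0_iff; field; exact HD. }
split.
- intros [H Huniq].
  assert (HD : (x + y)%C <> 0).
  { intros HD; destruct H as [Ht H].
    assert (Hy : y = (- x)%C).
    { replace y with (x + y - x)%C by ring; rewrite HD; ring. }
    assert (Hx : x = 0).
    { apply (Cmult_eq_0_iff 2 x C2_nz).
      replace (2 * x)%C with (x * (1 - r) + x * (1 + r))%C by ring.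
      rewrite H, Hy, Ht; ring. }
    (* With [x = y = 0] only [t = 1 + r] remains, so shifting [r] by 1 gives a second solution. *)
    destruct (Huniq (r + 1)%C (1 + (r + 1))%C) as [Hr _].
    - split; [reflexivity | rewrite Hy, Hx; ring].
    - apply C1_nz; replace (RtoC 1) with (r + 1 - r)%C by ring.
      rewrite Hr; ring. }
  split; [exact HD | now apply Hsol].
- intros (HD & Ht & Hr); split.
  + rewrite Ht, Hr; split; field; exact HD.
  + intros r' t' H; destruct (Hsol r' t' HD H) as [-> ->]; now split.
Qed.

(** The half-cell phase lies strictly between [-PI/2] and [PI/2], where the cosine is positive. This
    makes [D] a sum of two positive reals. *)
Lemma Ccos_half_pos (k : C) (d : R) : Im k = 0 -> Rabs (Re k * d) < PI ->
  exists x : R, 0 < x /\ Ccos (k * RtoC d / RtoC 2) = RtoC x.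
Proof.
intros Hk Hd; exists (cos (Re k * d / 2)); split.
- apply Rabs_def2 in Hd; apply cos_gt_0; lra.
- rewrite <- Ccos_RtoC; f_equal.
  destruct k as [x y]; simpl in *; subst y.
  change (x, 0) with (RtoC x).
  now rewrite RtoC_div, RtoC_mult by lra.
Qed.

Theorem theorem4 :
  forall (s : magnetic_setup) (E0 k1 k2 : C),
    E0 <> RtoC 0 ->
    yee_dispersion s (mu1 s) k1 ->
    yee_dispersion s (mu2 s) k2 ->
    let eta1 := RtoC (impedance s (mu1 s)) in
    let eta2 := RtoC (impedance s (mu2 s)) in
    let cos1 := Ccos (k1 * RtoC (dx s) / RtoC 2) in
    let cos2 := Ccos (k2 * RtoC (dx s) / RtoC 2) in
    let D := (eta2 * cos1 + eta1 * cos2)%C in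
    (* real wavenumbers in the open first Brillouin zone of the grid *)
    (Im k1 = 0 -> Im k2 = 0 ->
     Rabs (Re k1 * dx s) < PI -> Rabs (Re k2 * dx s) < PI -> D <> RtoC 0) /\
    (forall r t : C,
       fdtd_fresnel s E0 k1 k2 r t <->
       D <> RtoC 0 /\
       t = (RtoC 2 * eta2 * cos1 / D)%C /\
       r = ((eta2 * cos1 - eta1 * cos2) / D)%C).
Proof.
intros s E0 k1 k2 HE0 Hk1 Hk2 eta1 eta2 cos1 cos2 D; split.
- intros Hi1 Hi2 Hz1 Hz2.
  destruct (Ccos_half_pos k1 (dx s) Hi1 Hz1) as (x1 & Hx1 & Hc1).
  destruct (Ccos_half_pos k2 (dx s) Hi2 Hz2) as (x2 & Hx2 & Hc2).
  unfold D, cos1, cos2; rewrite Hc1, Hc2; unfold eta1, eta2.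
  rewrite <- !RtoC_mult, <- RtoC_plus; intros H; apply RtoC_inj in H.
  pose proof (impedance_pos s (mu1 s) (mu1_pos s)).
  pose proof (impedance_pos s (mu2 s) (mu2_pos s)).
  nra.
(* Regrouping [2 * eta2 * cos1] exposes the linear system with [x = eta2 * cos1] and
   [y = eta1 * cos2]. *)
- intros r t; unfold D; rewrite <- Cmult_assoc, <- unique_solution_iff.
  unfold fdtd_fresnel; rewrite interface_conditions_iff by assumption.
  split; intros [H Huniq]; (split; [exact H |]); intros r' t' H'; apply Huniq;
    now apply (interface_conditions_iff s E0 k1 k2 r' t' HE0 Hk1 Hk2).
Qed.
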